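(* Assume $\operatorname{char} R\neq 2$, and let $C|R$, $\sigma$, $i$, $s$, $H$, $w$, $N$, $\alpha$, the forms $g$ (on $C^4$) and $h$ (on $H^3$), the groups $\Xi$ and $\Psi$, the incidence structures $(U_g,\mathcal{B}_g,\in)$ and $(U_h,\mathcal{B}_h,\in)$, and the bijection $\eta\colon U_g\to U_h$ be as defined in the context. (a) The map $\varphi\colon\Xi\to\Psi\colon \xi\bigl((u_0,u_1),p\bigr)\mapsto\psi\bigl(u_0+wu_1,p\bigr)$ is an isomorphism of groups. (b) For each $u=(u_0,u_1)\in C^2$, each $p\in Ri$, and each point $P\in U_g$ we have $P^{\eta\,\psi(u_0+wu_1,p)}=P^{\xi(u,p)\,\eta}$. (c) The map $\eta\colon U_g\to U_h$ induces an isomorphism of incidence structures from $(U_g,\mathcal{B}_g,\in)$ onto $(U_h,\mathcal{B}_h,\in)$.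
   Context: Setting. $R$ is a commutative field, $C|R$ is a quadratic field extension with $\mathrm{Gal}(C|R)$ of order two, generated by $\sigma\colon x\mapsto\overline{x}$, and $\operatorname{char}R\ne2$. Choose $i\in C\smallsetminus\{0\}$ with $i^\sigma=-i$, and $s\in R\smallsetminus\{0\}$ such that the $\sigma$-hermitian form on $C^2$ with Gram matrix $\mathrm{diag}(1,s)$ is anisotropic (i.e. $a\overline{a}+sb\overline{b}\neq0$ for $(a,b)\neq(0,0)$). Let $H=\left\{\begin{pmatrix}a&x\\-s\overline{x}&\overline{a}\end{pmatrix} : a,x\in C\right\}$ (a quaternion field), $w=\begin{pmatrix}0&1\\-s&0\end{pmatrix}$, and embed $C$ in $H$ via $c\mapsto\mathrm{diag}(c,\overline{c})$. Then $H=C+wC$, with multiplication $(a+wb)(c+wd)=ac-s\overline{b}d+w(\overline{a}d+bc)$ for $a,b,c,d\in C$. The norm form is $N(a+wb)=a\overline{a}+sb\overline{b}$. The map $\alpha\colon H\to H\colon a+wb\mapsto\overline{a}+wb$ is an involutory anti-automorphism of $H$. Vector spaces are left vector spaces of rows; matrices act from the right, and maps are written as exponents and composed from left to right, so $P^{\eta\,\psi}=(P^\eta)^\psi$. For an invertible matrix $A$ over $C$ (or over $H$), $\lfloor A\rfloor$ denotes its class modulo central scalars in $\mathrm{PGL}(4,C)$ (or $\mathrm{PGL}(3,H)$). The forms are $g\colon C^4\times C^4\to C$, $g(x,y)=x_0y_3^\sigma+x_3y_0^\sigma+x_1y_1^\sigma+s\,x_2y_2^\sigma$ ($\sigma$-hermitian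 of Witt index $1$), and $h\colon H^3\times H^3\to H$, $h(X,Y)=X_0Y_2^\alpha+X_1Y_1^\alpha+X_2Y_0^\alpha$ ($\alpha$-hermitian of Witt index $1$). For a form $f\in\{g,h\}$ on $V$, $U_f$ is the set of one-dimensional subspaces $P$ of $V$ with $P\le P^{\perp_f}$ (absolute points). A block is a set of the form $\{P\in U_f: P\le L\}$, with $L$ a two-dimensional subspace of $V$, that contains more than one point; $\mathcal{B}_f$ is the set of all blocks. An isomorphism from $(U_g,\mathcal{B}_g,\in)$ onto $(U_h,\mathcal{B}_h,\in)$ is a bijection from $U_g$ onto $U_h$ that maps each block in $\mathcal{B}_g$ onto a block in $\mathcal{B}_h$ such that the resulting map $\mathcal{B}_g\to\mathcal{B}_h$ is a bijection. $\Xi=\{\xi(u,p): u\in C^2,\ p\in Ri\}\subseteq\mathrm{PGL}(4,C)$ and $\Psi=\{\psi(X,p): X\in H,\ p\in Ri\}\subseteq\mathrm{PGL}(3,H)$ are the groups consisting of $$\xi\bigl((u_0,u_1),p\bigr)=\left\lfloor\begin{matrix}1&u_0&u_1&p-\frac12N(u_0+wu_1)\\0&1&0&-u_0^\sigma\\0&0&1&-su_1^\sigma\\0&0&0&1\end{matrix}\right\rfloor,\qquad \psi(X,p)=\left\lfloor\begin{matrix}1&X&p-\frac12XX^\alpha\\0&1&-X^\alpha\\0&0&1\end{matrix}\right\rfloor.$$ The bijection $\eta\colon U_g\to U_h$ is given by $C(0,0,0,1)^\eta=H(0,0,1)$ and, for $u=(u_0,u_1)\in C^2$ and $p\in Ri$,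 $$C\bigl(1,u_0,u_1,p-\tfrac12N(u_0+wu_1)\bigr)^\eta=H\bigl(1,u_0+wu_1,p-\tfrac12(u_0+wu_1)(u_0+wu_1)^\alpha\bigr).$$ *)

(* Defs.v *)
From HB Require Import structures.
From mathcomp Require Import all_boot all_order all_algebra all_fingroup all_field.
From mathcomp Require Import all_classical.

Set Implicit Arguments.
Unset Strict Implicit.
Unset Printing Implicit Defensive.

Import GRing.Theory.
Local Open Scope classical_set_scope.
Local Open Scope ring_scope.

Definition row_of_seq (D : nzRingType) n (l : seq D) : 'rV[D]_n :=
  \row_j l`_j.

Definition mx_of_rows (D : nzRingType) m n (l : seq (seq D)) : 'M[D]_(m, n) :=
  \matrix_(i, j) (nth [::] l i)`_j.

Definition mx_invertible (D : nzRingType) n (A : 'M[D]_n) : Prop :=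
  exists B : 'M[D]_n, A *m B = 1%:M /\ B *m A = 1%:M.

Definition mx_invertibleb (D : nzRingType) n : pred 'M[D]_n :=
  fun A => `[< mx_invertible A >].

Record GL (D : nzRingType) n := GLmx {
  mx_of_GL :> 'M[D]_n;
  _ : mx_invertibleb mx_of_GL }.

HB.instance Definition _ (D : nzRingType) n := [isSub for @mx_of_GL D n].
HB.instance Definition _ (D : nzRingType) n := [Choice of GL D n by <:].

Section GLgroup.
Variables (D : nzRingType) (n : nat).
Implicit Types A B : GL D n.

Lemma GL_invertible A : mx_invertible (val A).
Proof. exact/asboolP/(valP A). Qed.

Lemma mx_invertible1 : mx_invertible (1%:M : 'M[D]_n).
Proof. by exists 1%:M; rewrite mulmx1. Qed.

Lemma mx_invertibleM (A B : 'M[D]_n) :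
  mx_invertible A -> mx_invertible B -> mx_invertible (A *m B).
Proof.
move=> [A' [AA' A'A]] [B' [BB' B'B]]; exists (B' *m A').
by rewrite !mulmxA -(mulmxA A) BB' mulmx1 AA' -(mulmxA B') A'A mulmx1 B'B.
Qed.

Definition GL_of (A : 'M[D]_n) (h : mx_invertible A) : GL D n :=
  GLmx (introT (asboolP _) h).

Definition GL_one := GL_of mx_invertible1.

Definition GL_mul A B := GL_of (mx_invertibleM (GL_invertible A) (GL_invertible B)).

Definition invmxD A : 'M[D]_n := projT1 (cid (GL_invertible A)).

Lemma invmxDP A : val A *m invmxD A = 1%:M /\ invmxD A *m val A = 1%:M.
Proof. exact: (projT2 (cid (GL_invertible A))). Qed.

Lemma invmxD_invertible A : mx_invertible (invmxD A).
Proof. by exists (val A); case: (invmxDP A). Qed.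

Definition GL_inv A := GL_of (invmxD_invertible A).

Fact GL_mulA : associative GL_mul.
Proof. by move=> A B E; apply/val_inj; rewrite /= mulmxA. Qed.
Fact GL_mul1g : left_id GL_one GL_mul.
Proof. by move=> A; apply/val_inj; rewrite /= mul1mx. Qed.
Fact GL_mulg1 : right_id GL_one GL_mul.
Proof. by move=> A; apply/val_inj; rewrite /= mulmx1. Qed.
Fact GL_mulVg : left_inverse GL_one GL_inv GL_mul.
Proof. by move=> A; apply/val_inj; case: (invmxDP A). Qed.
Fact GL_mulgV : right_inverse GL_one GL_inv GL_mul.
Proof. by move=> A; apply/val_inj; case: (invmxDP A). Qed.

HB.instance Definition _ :=
  isGroup.Build (GL D n) GL_mulA GL_mul1g GL_mulg1 GL_mulVg GL_mulgV.
End GLgroup.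

Section PGLgroup.
Variables (D : unitRingType) (n : nat).

Definition central (c : D) : Prop := forall d : D, c * d = d * c.

Definition scalar_equiv (A B : GL D n) : Prop :=
  exists c : D, [/\ c \is a GRing.unit, central c & val A = c *: val B].

Lemma centralV c : central c -> central c^-1.
Proof. by move=> h d; apply/esym; apply: commrV; apply/esym/h. Qed.

Lemma central_scalemxAr c (A B : 'M[D]_n) :
  central c -> A *m (c *: B) = c *: (A *m B).
Proof.
move=> h; apply/matrixP => i j; rewrite !mxE big_distrr /=.
by apply: eq_bigr => k _; rewrite !mxE !mulrA h.
Qed.

Definition scalar_equivb : rel (GL D n) := fun A B => `[< scalar_equiv A B >].

Fact scalar_equiv_refl : reflexive scalar_equivb.
Proof.
by move=> A; apply/asboolP; exists 1; split;
  rewrite ?unitr1 ?scale1r // => d; rewrite mul1r mulr1.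
Qed.

Fact scalar_equiv_sym : symmetric scalar_equivb.
Proof.
suff h A B : scalar_equiv A B -> scalar_equiv B A
  by move=> A B; apply/asboolP/asboolP; apply: h.
case=> c [uc hc AB]; exists c^-1; split; rewrite ?unitrV //; first exact: centralV.
by rewrite AB scalerA mulVr // scale1r.
Qed.

Fact scalar_equiv_trans : transitive scalar_equivb.
Proof.
move=> B A E /asboolP[c [uc hc AB]] /asboolP[d [ud hd BE]].
apply/asboolP; exists (c * d); split; first by rewrite unitrMl.
  by move=> x; rewrite -mulrA hd mulrA hc mulrA.
by rewrite AB BE scalerA.
Qed.

Canonical scalar_equiv_rel :=
  EquivRel scalar_equivb scalar_equiv_refl scalar_equiv_sym scalar_equiv_trans.

Definition PGL : Type := {eq_quot scalar_equivb}%qT.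

HB.instance Definition _ := Choice.on PGL.
HB.instance Definition _ := Quotient.on PGL.

Definition PGL_class (A : GL D n) : PGL := (\pi_PGL A)%qT.

Definition mxclass (A : 'M[D]_n) (h : mx_invertible A) : PGL :=
  PGL_class (GL_of h).

Lemma PGL_classP A B : PGL_class A = PGL_class B <-> scalar_equiv A B.
Proof.
split=> [/eqP h|h]; first by apply/asboolP; move: h; rewrite eqmodE.
by apply/eqP; rewrite eqmodE; apply/asboolP.
Qed.

Lemma mxclassP A B (hA : mx_invertible A) (hB : mx_invertible B) :
  mxclass hA = mxclass hB <->
  exists c : D, [/\ c \is a GRing.unit, central c & A = c *: B].
Proof. exact: PGL_classP. Qed.

Definition PGL_repr (X : PGL) : GL D n := generic_quotient.repr X.

Lemma PGL_reprK (X : PGL) : PGL_class (PGL_repr X) = X.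
Proof. exact: generic_quotient.reprK. Qed.

Lemma PGL_repr_equiv A : scalar_equiv (PGL_repr (PGL_class A)) A.
Proof. by apply/PGL_classP; rewrite PGL_reprK. Qed.

Definition PGL_one : PGL := PGL_class 1%g.
Definition PGL_mul (X Y : PGL) : PGL := PGL_class (PGL_repr X * PGL_repr Y)%g.
Definition PGL_inv (X : PGL) : PGL := PGL_class (PGL_repr X)^-1%g.

Lemma PGL_classM A B : PGL_class (A * B)%g = PGL_mul (PGL_class A) (PGL_class B).
Proof.
apply/esym/PGL_classP.
have [c [uc hc AE]] := PGL_repr_equiv A; have [d [ud hd BE]] := PGL_repr_equiv B.
exists (c * d); split; first by rewrite unitrMl.
  by move=> x; rewrite -mulrA hd mulrA hc mulrA.
rewrite /= in AE BE *.
by rewrite AE BE -scalemxAl central_scalemxAr // scalerA.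
Qed.

Fact PGL_mulA : associative PGL_mul.
Proof.
move=> X Y Z; rewrite -(PGL_reprK X) -(PGL_reprK Y) -(PGL_reprK Z).
by rewrite -!PGL_classM mulgA.
Qed.
Fact PGL_mul1g : left_id PGL_one PGL_mul.
Proof. by move=> X; rewrite -(PGL_reprK X) -PGL_classM mul1g. Qed.
Fact PGL_mulg1 : right_id PGL_one PGL_mul.
Proof. by move=> X; rewrite -(PGL_reprK X) -PGL_classM mulg1. Qed.
Fact PGL_mulVg : left_inverse PGL_one PGL_inv PGL_mul.
Proof. by move=> X; rewrite -{2}(PGL_reprK X) -PGL_classM mulVg. Qed.
Fact PGL_mulgV : right_inverse PGL_one PGL_inv PGL_mul.
Proof. by move=> X; rewrite -{1}(PGL_reprK X) -PGL_classM mulgV. Qed.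

HB.instance Definition _ :=
  isGroup.Build PGL PGL_mulA PGL_mul1g PGL_mulg1 PGL_mulVg PGL_mulgV.

(* On subspaces the choice of representative is irrelevant, see PGL_actE. *)
Definition PGL_act (P : set 'rV[D]_n) (X : PGL) : set 'rV[D]_n :=
  [set x *m val (PGL_repr X) | x in P].

Lemma PGL_actE (P : set 'rV[D]_n) (A : 'M[D]_n) (h : mx_invertible A) :
  (forall (c : D) x, P x -> P (c *: x)) ->
  PGL_act P (mxclass h) = [set x *m A | x in P].
Proof.
move=> PZ; have [c [uc hc /= E]] := PGL_repr_equiv (GL_of h).
have move_c (x : 'rV[D]_n) d : central d -> x *m (d *: A) = (d *: x) *m A.
  move=> hd; apply/rowP => j; rewrite !mxE; apply: eq_bigr => k _.
  by rewrite !mxE mulrA hd.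
rewrite /PGL_act /mxclass /= E; apply/seteqP; split=> _ [x Px <-].
  by exists (c *: x); [exact: PZ | rewrite move_c].
exists (c^-1 *: x); first exact: PZ.
by rewrite move_c // scalerA divrr // scale1r.
Qed.
End PGLgroup.

Definition group_iso (G K : groupType) (A : set G) (B : set K) (phi : G -> K) :=
  [/\ group_closed [in A], group_closed [in B], set_bij A B phi &
      {in A &, {morph phi : x y / (x * y)%g}}].

Section Blocks.
Variables (D : unitRingType) (n : nat).
Implicit Types (P L : set 'rV[D]_n) (f : 'rV[D]_n -> 'rV[D]_n -> D).

Definition is_subspace (k : nat) L : Prop :=
  exists B : 'M[D]_(k, n),
    (forall c : 'rV[D]_k, c *m B = 0 -> c = 0) /\ L = [set c *m B | c in setT].

Definition span1 (v : 'rV[D]_n) : set 'rV[D]_n := [set c *: v | c in setT].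

Definition perp f P : set 'rV[D]_n := [set y | forall x, P x -> f x y = 0].

Definition absolute_points f : set (set 'rV[D]_n) :=
  [set P | is_subspace 1 P /\ P `<=` perp f P].

Definition points_on f L : set (set 'rV[D]_n) :=
  [set P | absolute_points f P /\ P `<=` L].

Definition blocks f : set (set (set 'rV[D]_n)) :=
  [set b | exists L, [/\ is_subspace 2 L, b = points_on f L &
                         exists P Q, [/\ b P, b Q & P <> Q]]].
End Blocks.

Definition incidence_iso (D D' : unitRingType) n n'
    (f : 'rV[D]_n -> 'rV[D]_n -> D) (f' : 'rV[D']_n' -> 'rV[D']_n' -> D')
    (eta : set 'rV[D]_n -> set 'rV[D']_n') : Prop :=
  set_bij (absolute_points f) (absolute_points f') eta /\
  set_bij (blocks f) (blocks f') (fun b => [set eta P | P in b]).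

Definition quadratic_galois (R : fieldType) (C : splittingFieldType R)
    (sigma : gal_of {:C}) : Prop :=
  [/\ \dim {:C} = 2%N, #|'Gal({:C} / 1)%g| = 2%N & ('Gal({:C} / 1) = <[sigma]>)%g].

Lemma conjKP (R : fieldType) (C : splittingFieldType R) (sigma : gal_of {:C}) :
  quadratic_galois sigma -> involutive sigma.
Proof.
case=> _ c2 gen x; have o2 : #[sigma]%g = 2%N by rewrite orderE -gen.
have e1 : (sigma * sigma)%g = 1%g by rewrite -[LHS]/((sigma ^+ 2)%g) -o2 expg_order.
by rewrite -galM ?memvf // e1 gal_id.
Qed.

Section Quaternions.
Variables (R : fieldType) (C : splittingFieldType R) (sigma : gal_of {:C}).
Variables (s : R) (hsigma : quadratic_galois sigma).

Definition quat_mx (a x : C) : 'M[C]_2 :=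
  mx_of_rows 2 2 [:: [:: a; x]; [:: - (s *: sigma x); sigma a]].

(* The proof argument only serves to infer the closure properties below. *)
Definition in_quat (_ : quadratic_galois sigma) : pred 'M[C]_2 :=
  fun A => A == quat_mx (A 0 0) (A 0 1).

Definition in_H := in_quat hsigma.

Let sK : involutive sigma := conjKP hsigma.

Lemma quat_mxE a x i j :
  quat_mx a x i j = (nth [::] [:: [:: a; x]; [:: - (s *: sigma x); sigma a]] i)`_j.
Proof. by rewrite mxE. Qed.

Lemma mem_quat_mx a x : quat_mx a x \in in_H.
Proof. by rewrite unfold_in /in_H /in_quat !quat_mxE. Qed.

Lemma in_HP A : reflect (exists a x, A = quat_mx a x) (A \in in_H).
Proof.
apply: (iffP idP) => [/eqP ->|[a [x ->]]]; last exact: mem_quat_mx.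
by do 2!eexists.
Qed.

Lemma eq_mx2 (A B : 'M[C]_2) :
  A 0 0 = B 0 0 -> A 0 1 = B 0 1 -> A 1 0 = B 1 0 -> A 1 1 = B 1 1 -> A = B.
Proof.
move=> h00 h01 h10 h11; apply/matrixP => i j.
have ord2 (k : 'I_2) : k = 0 \/ k = 1.
  by case: k => [[|[|//]] ?]; [left|right]; apply/val_inj.
by case: (ord2 i) => ->; case: (ord2 j) => ->.
Qed.

Lemma sigmaZ (c : R) a : sigma (c *: a) = c *: sigma a.
Proof. exact: linearZ. Qed.

Lemma quat_mxB a x b y : quat_mx a x - quat_mx b y = quat_mx (a - b) (x - y).
Proof.
apply: eq_mx2; rewrite !mxE /= ?rmorphB //.
by rewrite scalerBr opprB opprK addrC.
Qed.

Lemma quat_mxM a x b y : quat_mx a x *m quat_mx b y =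
  quat_mx (a * b - s *: (x * sigma y)) (a * y + x * sigma b).
Proof.
apply: eq_mx2; rewrite !mxE !big_ord_recl big_ord0 !mxE /= addr0.
- by rewrite mulrN -scalerAr.
- by [].
- rewrite rmorphD !rmorphM /= sK scalerDr opprD mulNr mulrN -scalerAl -scalerAr.
  by rewrite addrC.
by rewrite rmorphB /= sigmaZ !rmorphM /= sK mulNr -scalerAl addrC.
Qed.

Lemma quat_mx1 : quat_mx 1 0 = 1.
Proof. by apply: eq_mx2; rewrite !mxE /= ?rmorph0 ?scaler0 ?oppr0 ?rmorph1. Qed.

Lemma det_quat_mx a x : \det (quat_mx a x) = a * sigma a + s *: (x * sigma x).
Proof.
rewrite (expand_det_row _ 0) !big_ord_recl big_ord0 addr0 /cofactor !det_mx11.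
by rewrite !mxE /= expr0 mul1r expr1 mulN1r opprK -scalerAr.
Qed.

Lemma quat_mx_adj a x : quat_mx a x *m quat_mx (sigma a) (- x) =
  (a * sigma a + s *: (x * sigma x))%:M.
Proof.
rewrite quat_mxM sK rmorphN /= !mulrN scalerN opprK (mulrC a x) addNr.
apply: eq_mx2; rewrite !mxE //= ?rmorph0 ?scaler0 ?oppr0 //.
by rewrite rmorphD /= sigmaZ !rmorphM /= !sK mulrC (mulrC (sigma x)).
Qed.

Fact in_H_divring_closed : divring_closed in_H.
Proof.
have HB : GRing.subr_closed in_H.
  by move=> _ _ /in_HP[a [x ->]] /in_HP[b [y ->]]; rewrite quat_mxB mem_quat_mx.
have HM A B : A \in in_H -> B \in in_H -> A * B \in in_H.
  by move=> /in_HP[a [x ->]] /in_HP[b [y ->]]; rewrite [_ * _]quat_mxM mem_quat_mx.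
have H1 : 1 \in in_H by rewrite -quat_mx1 mem_quat_mx.
split=> // A _ AH /in_HP[b [y ->]]; apply: (HM) => //.
set B := quat_mx b y; have [uB|nuB] := boolP (B \is a GRing.unit); last first.
  by rewrite invr_out // mem_quat_mx.
set d := b * sigma b + s *: (y * sigma y).
have d0 : d != 0.
  by move: uB; rewrite -[_ \is a _]/(B \in unitmx) unitmxE det_quat_mx unitfE.
have sd : sigma d = d
  by rewrite /d rmorphD /= sigmaZ !rmorphM /= !sK mulrC (mulrC (sigma y)).
suff -> : B^-1 = quat_mx (d^-1) 0 *m quat_mx (sigma b) (- y)
  by apply: (HM); exact: mem_quat_mx.
have dE : quat_mx d^-1 0 = d^-1%:M.
  by apply: eq_mx2; rewrite !mxE //= ?rmorph0 ?scaler0 ?oppr0 // fmorphV /= sd.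
rewrite -[LHS]mulr1; apply: (canLR (mulKr uB)).
by rewrite dE mul_scalar_mx -[RHS]/(B *m _) -scalemxAr quat_mx_adj scale_scalar_mx mulVf.
Qed.

Record quat := Quat { mx_of_quat :> 'M[C]_2; _ : mx_of_quat \in in_H }.

HB.instance Definition _ := [isSub for mx_of_quat].
HB.instance Definition _ := [Choice of quat by <:].
HB.instance Definition _ :=
  GRing.SubChoice_isSubUnitRing.Build 'M[C]_2 in_H quat in_H_divring_closed.

Definition mkquat (a x : C) : quat := Quat (mem_quat_mx a x).

Definition emb (c : C) : quat := mkquat c 0.
Definition qw : quat := mkquat 0 1.

(* The coordinates of X = a + w b with a, b in C. *)
Definition qa (X : quat) : C := val X 0 0.
Definition qb (X : quat) : C := sigma (val X 0 1).

Definition of_pair (u : C * C) : quat := emb u.1 + qw * emb u.2.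

Lemma val_emb c : val (emb c) = mx_of_rows 2 2 [:: [:: c; 0]; [:: 0; sigma c]].
Proof. by apply: eq_mx2; rewrite !mxE //= rmorph0 scaler0 oppr0. Qed.

Lemma val_qw : val qw = mx_of_rows 2 2 [:: [:: 0; 1]; [:: - s%:A; 0]].
Proof. by apply: eq_mx2; rewrite !mxE //= ?rmorph1 ?rmorph0. Qed.

Lemma of_pairE u : of_pair u = mkquat u.1 (sigma u.2).
Proof.
apply/val_inj; rewrite /of_pair rmorphD rmorphM /= [_ * _]quat_mxM.
by apply: eq_mx2; rewrite !mxE /= ?(rmorph0, scaler0, mul0r, mulr0, mul1r, subr0,
  addr0, add0r, oppr0, sK).
Qed.

Lemma qaE u : qa (of_pair u) = u.1.
Proof. by rewrite of_pairE /qa /= mxE. Qed.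

Lemma qbE u : qb (of_pair u) = u.2.
Proof. by rewrite of_pairE /qb /= mxE /= sK. Qed.

Lemma of_pairK X : of_pair (qa X, qb X) = X.
Proof. by apply/val_inj; rewrite of_pairE /= sK; apply/esym/eqP/(valP X). Qed.

Lemma of_pairM a b c d : of_pair (a, b) * of_pair (c, d) =
  of_pair (a * c - s *: (sigma b * d), sigma a * d + b * c).
Proof.
apply/val_inj; rewrite rmorphM !of_pairE [_ * _]quat_mxM /= sK.
by rewrite rmorphD !rmorphM /= sK.
Qed.

Definition qnorm (X : quat) : C := qa X * sigma (qa X) + s *: (qb X * sigma (qb X)).

Definition qalpha (X : quat) : quat := of_pair (sigma (qa X), qb X).

Lemma quat_unitE X : (X \is a GRing.unit) = (qnorm X != 0).
Proof.
have vU : (X \is a GRing.unit) = (val X \is a GRing.unit) by [].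
rewrite vU /qnorm /qb sK (mulrC (sigma _)) /qa.
rewrite -det_quat_mx -unitfE; move/eqP: (valP X) => {1}->.
by rewrite [LHS]unitmxE.
Qed.

Lemma quat_division :
  (forall a b : C, (a, b) != (0, 0) -> a * sigma a + s *: (b * sigma b) != 0) ->
  forall X : quat, X != 0 -> X \is a GRing.unit.
Proof.
move=> aniso X; rewrite quat_unitE => X0; apply: aniso.
apply: contraNneq X0 => -[a0 b0]; rewrite -(of_pairK X) a0 b0 of_pairE /=.
by apply/eqP/val_inj; apply: eq_mx2; rewrite !mxE /= ?rmorph0 ?scaler0 ?oppr0.
Qed.

Definition g (x y : 'rV[C]_4) : C :=
  x 0 0 * sigma (y 0 3) + x 0 3 * sigma (y 0 0)
  + x 0 1 * sigma (y 0 1) + s *: (x 0 2 * sigma (y 0 2)).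

Definition h (X Y : 'rV[quat]_3) : quat :=
  X 0 0 * qalpha (Y 0 2) + X 0 1 * qalpha (Y 0 1) + X 0 2 * qalpha (Y 0 0).

(* p - N(u_0 + w u_1) / 2 *)
Definition xi_entry (u : C * C) (p : C) : C := p - 2^-1 * qnorm (of_pair u).

(* p - X X^alpha / 2 *)
Definition psi_entry (X : quat) (p : C) : quat := emb p - 2^-1 * (X * qalpha X).

Definition xi_mx (u : C * C) (p : C) : 'M[C]_4 := mx_of_rows 4 4
  [:: [:: 1; u.1; u.2; xi_entry u p];
      [:: 0; 1;   0;   - sigma u.1];
      [:: 0; 0;   1;   - (s *: sigma u.2)];
      [:: 0; 0;   0;   1]].

Definition psi_mx (X : quat) (p : C) : 'M[quat]_3 := mx_of_rows 3 3
  [:: [:: 1; X; psi_entry X p];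
      [:: 0; 1; - qalpha X];
      [:: 0; 0; 1]].

Lemma xi_mx_invertible u p : mx_invertible (xi_mx u p).
Proof.
have U : xi_mx u p \in unitmx.
  rewrite unitmxE -det_tr det_trig; last first.
    apply/is_trig_mxP => i j.
    by case: i => [[|[|[|[|//]]]] ?]; case: j => [[|[|[|[|//]]]] ?];
      rewrite ?mxE.
  rewrite (eq_bigr (fun=> 1)) ?big1 ?unitr1 // => i _.
  by case: i => [[|[|[|[|//]]]] ?]; rewrite !mxE.
by exists (invmx (xi_mx u p)); rewrite mulmxV // mulVmx.
Qed.

Lemma psi_mx_invertible X p : mx_invertible (psi_mx X p).
Proof.
exists (mx_of_rows 3 3 [:: [:: 1; - X; - psi_entry X p - X * qalpha X];
                           [:: 0; 1; qalpha X]; [:: 0; 0; 1]]).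
split; apply/matrixP => i j; rewrite !mxE !big_ord_recl big_ord0 !mxE /=;
  case: i => [[|[|[|//]]] ?]; case: j => [[|[|[|//]]] ?] /=;
  rewrite ?(mul1r, mul0r, mulr0, mulr1, addr0, add0r, mulrN, mulNr, opprK,
            subrr, addNr) //.
  by rewrite addrA addrNK addrC subrr.
by rewrite addrA -opprD subrr.
Qed.

Definition xi (u : C * C) (p : C) : PGL C 4 := mxclass (xi_mx_invertible u p).
Definition psi (X : quat) (p : C) : PGL quat 3 := mxclass (psi_mx_invertible X p).

(* R i is the R-line <[i]> in the R-vector space C. *)
Definition Xi (i : C) : set (PGL C 4) :=
  [set x | exists u p, p \in <[i]>%VS /\ x = xi u p].

Definition Psi (i : C) : set (PGL quat 3) :=
  [set x | exists X p, p \in <[i]>%VS /\ x = psi X p].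

(* Every absolute point of g is one of those listed here, so is_eta determines
   eta on the absolute points; elsewhere eta is unconstrained. *)
Definition is_eta (i : C) (eta : set 'rV[C]_4 -> set 'rV[quat]_3) : Prop :=
  eta (span1 (row_of_seq 4 [:: 0; 0; 0; 1])) = span1 (row_of_seq 3 [:: 0; 0; 1]) /\
  forall (u : C * C) (p : C), p \in <[i]>%VS ->
    eta (span1 (row_of_seq 4 [:: 1; u.1; u.2; xi_entry u p])) =
    span1 (row_of_seq 3 [:: 1; of_pair u; psi_entry (of_pair u) p]).

Lemma is_eta_exists i : exists eta, is_eta i eta.
Proof.
pose rel P Q :=
  (P = span1 (row_of_seq 4 [:: 0; 0; 0; 1]) /\
   Q = span1 (row_of_seq 3 [:: 0; 0; 1])) \/
  exists u p, P = span1 (row_of_seq 4 [:: 1; u.1; u.2; xi_entry u p]) /\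
    Q = span1 (row_of_seq 3 [:: 1; of_pair u; psi_entry (of_pair u) p]).
have rel_fun P Q Q' : rel P Q -> rel P Q' -> Q = Q'.
  have self n (v : 'rV[C]_n) : span1 v v by exists 1 => //; rewrite scale1r.
  have no u p : span1 (row_of_seq 4 [:: 0; 0; 0; 1]) <>
                span1 (row_of_seq 4 [:: 1; u.1; u.2; xi_entry u p]).
    move=> E; have := self _ (row_of_seq 4 [:: 1; u.1; u.2; xi_entry u p]).
    rewrite -E => -[c _ /rowP/(_ 0)/eqP].
    by rewrite !mxE /= mulr0 eq_sym oner_eq0.
  case=> [[-> ->]|[u [p [-> ->]]]] [[E ->]|[v [q [E ->]]]].
  - exact: erefl.
  - by case: (no v q); exact: E.
  - by case: (no u p); exact/esym.
  have := self _ (row_of_seq 4 [:: 1; u.1; u.2; xi_entry u p]).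
  rewrite E => -[c _ cE].
  have c1 : c = 1 by move/rowP/(_ 0): cE; rewrite !mxE /= mulr1.
  move: cE; rewrite c1 scale1r => cE.
  have u1 : v.1 = u.1 by move/rowP/(_ 1): cE; rewrite !mxE.
  have u2 : v.2 = u.2 by move/rowP/(_ 2): cE; rewrite !mxE.
  have uv : v = u by rewrite (surjective_pairing v) u1 u2 -surjective_pairing.
  have : xi_entry v q = xi_entry u p by move/rowP/(_ 3): cE; rewrite !mxE.
  by rewrite uv => /addIr ->.
exists (fun P => xget setT [set Q | rel P Q]); split=> [|u p _];
  apply: xget_unique => [|Q].
- by left.
- by move=> hQ; apply: rel_fun hQ _; left.
- by right; exists u, p.
by move=> hQ; apply: rel_fun hQ _; right; exists u, p.
Qed.
End Quaternions.

Arguments h {R C sigma} s hsigma X Y.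
Arguments Psi {R C sigma} s hsigma i _.

(* Main.v *)
Require Import Defs.
From mathcomp Require Import all_boot all_order all_algebra all_fingroup all_field.
From mathcomp Require Import all_classical.
From mathcomp Require Import ring.

Import GRing.Theory.
Local Open Scope classical_set_scope.
Local Open Scope ring_scope.

(** By anisotropy only one absolute point of each form, called infinity below, has
    first coordinate 0.  Every other absolute point has a unique spanning row with
    first coordinate 1, and solving f(x, x) = 0 for the last coordinate shows that
    it is (1, u, e(u, p)), where e(u, p) is [xi_entry] or [psi_entry] and p runs
    over the elements with conjugate - p, that is, over R i ([antifixedP]).  So
    both sets of points are charted by the same index set, and eta is the identity
    in these charts ([g_chart], [h_chart], [eta_pt]).

    The index set without infinity is a group of Heisenberg type, with law
    (u, p)(v, q) = (u + v, p + q - (<u, v> - <v, u>) / 2), <u, v> being the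
    hermitian form with Gram matrix diag(1, s).  Since
    X Y^alpha - Y X^alpha = <u, v> - <v, u> for X = u_0 + w u_1 and
    Y = v_0 + w v_1, both families of matrices multiply by this law
    ([xi_parM], [psi_parM]), and the first row of such a product describes the
    action on points.  As an element of Xi or Psi is recovered from the image of
    the origin (1, 0, 0), this gives the group isomorphism and the equivariance
    of eta.

    A block is the set of absolute points on the join of two of them, so eta is an
    isomorphism of incidence structures as soon as it preserves and reflects
    collinearity of triples of absolute points ([chart_incidence_iso]).  By the
    equivariance one of the two points defining the line may be moved to the origin.
    If infinity is involved, the condition says on both sides that the remaining
    finite point (u, p) has u = 0.  Otherwise it says that
    (v, e(v, q)) is a left multiple of (u, e(u, p)), over C or over H, and
    here the two sides look different: a left factor c in C acts on
    u_0 + w u_1 as a factor on the right.  The bridge is the identity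
    E(X, p) X~ = X e(u, p) for X = u_0 + w u_1, X~ = u_0 - w u_1, with
    E and e the last coordinates over H and C ([psi_entry_twist]): from a factor c
    in C it produces the factor X c X^-1 in H, and from a factor in H it recovers
    c = e(v, q) / e(u, p) ([multipleE]). *)

Set Implicit Arguments.
Unset Strict Implicit.

(** * Lines over a division ring and blocks *)

Section DivisionRing.
Variables (D : unitRingType) (n : nat).
Hypothesis divD : forall c : D, c != 0 -> c \is a GRing.unit.
Implicit Types (x y a b v : 'rV[D]_n) (c d : D) (P L : set 'rV[D]_n).

Definition span2 x y : set 'rV[D]_n := [set v | exists c d, v = c *: x + d *: y].

Lemma span1_id v : span1 v v.
Proof. by exists 1; rewrite // scale1r. Qed.

Lemma span1Z c v : c != 0 -> span1 (c *: v) = span1 v.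
Proof.
move=> c0; apply/seteqP; split=> _ [d _ <-]; first by exists (d * c); rewrite ?scalerA.
by exists (d * c^-1); rewrite // scalerA -mulrA mulVr ?divD ?mulr1.
Qed.

Lemma span1_eq x y : span1 x y -> y != 0 -> span1 x = span1 y.
Proof.
move=> [c _ <-] cx0; rewrite span1Z //.
by apply: contraNneq cx0 => ->; rewrite scale0r.
Qed.

Lemma span2C x y : span2 x y = span2 y x.
Proof. by apply/seteqP; split=> _ [c [d ->]]; exists d, c; rewrite addrC. Qed.

Lemma span2_l x y : span2 x y x.
Proof. by exists 1, 0; rewrite scale1r scale0r addr0. Qed.

Lemma span2_r x y : span2 x y y.
Proof. by rewrite span2C; apply: span2_l. Qed.

Lemma span2Z c x y v : span2 x y v -> span2 x y (c *: v).
Proof.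
by move=> [a [b ->]]; exists (c * a), (c * b); rewrite scalerDr !scalerA.
Qed.

Lemma span2_sub x y a b : span2 x y a -> span2 x y b -> span2 a b `<=` span2 x y.
Proof.
move=> [c [d ->]] [c' [d' ->]] _ [e [e' ->]].
exists (e * c + e' * c'), (e * d + e' * d').
by rewrite !scalerDr !scalerA !scalerDl addrACA.
Qed.

Lemma span1_sub_span2 x y v : (span1 v `<=` span2 x y) <-> span2 x y v.
Proof.
by split=> [|vL _ [c _ <-]]; [apply; apply: span1_id | apply: span2Z].
Qed.

Lemma span2_exchange1 a b c d : c != 0 ->
  span2 (c *: a + d *: b) b = span2 a b.
Proof.
move=> c0; apply/seteqP; split; apply: span2_sub; try exact: span2_r.
  by exists c, d.
exists c^-1, (- (c^-1 * d)).
by rewrite scalerDr !scalerA mulVr ?divD // scale1r scaleNr addrK.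
Qed.

(** The Steinitz exchange step, by which two distinct points determine their line. *)
Lemma span2_exchange a b x y :
  span2 a b x -> span2 a b y -> x != 0 -> ~ span1 x y -> span2 a b = span2 x y.
Proof.
wlog cne0 : a b / exists c d, x = c *: a + d *: b /\ c != 0 => [wl|].
  move=> xL yL x0 xy; have [c [d xE]] := xL.
  have [c0|cn0] := eqVneq c 0; last by apply: wl => //; exists c, d.
  rewrite span2C; apply: wl; rewrite // 1?span2C //.
  exists d, c; rewrite addrC -xE; split=> //; apply: contraNneq x0 => d0.
  by rewrite xE c0 d0 !scale0r addr0.
have [c [d [-> c0]]] := cne0; move=> _ yL _ xy.
rewrite -(span2_exchange1 _ _ d c0) in yL *; set z := _ + _ in xy yL *.
have [e [k yE]] := yL.
have k0 : k != 0.
  by apply/eqP => k0; apply: xy; exists e; rewrite // yE k0 scale0r addr0.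
rewrite span2C [RHS]span2C; have -> : y = k *: b + e *: z by rewrite addrC.
by rewrite span2_exchange1.
Qed.

Lemma is_subspace1P P :
  is_subspace 1 P <-> exists2 v, v != 0 & P = span1 v.
Proof.
have rE (c : 'rV[D]_1) (B : 'M[D]_(1, n)) : c *m B = c 0 0 *: row 0 B.
  by rewrite mulmx_sum_row big_ord1.
split=> [[B [Bfree ->]]|[v v0 ->]].
  exists (row 0 B); last first.
    apply/seteqP; split=> _ [c _ <-]; first by exists (c 0 0); rewrite ?rE.
    by exists c%:M; rewrite // rE mxE eqxx.
  apply/eqP => B0; have := Bfree 1%:M; rewrite rE B0 scaler0.
  by move=> /(_ erefl)/rowP/(_ 0)/eqP; rewrite !mxE eqxx oner_eq0.
exists v; split=> [c|].
  rewrite rE row_id; have [c0 _|c0 cv] := eqVneq (c 0 0) 0.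
    by apply/rowP => j; rewrite ord1 c0 mxE.
  by case/eqP: v0; rewrite -[v]scale1r -(mulVr (divD c0)) -scalerA cv scaler0.
apply/seteqP; split=> _ [c _ <-]; last by exists (c 0 0); rewrite // rE row_id.
by exists c%:M; rewrite // rE row_id mxE eqxx.
Qed.

Lemma is_subspace2P L :
  is_subspace 2 L <-> exists x y, [/\ x != 0, ~ span1 x y & L = span2 x y].
Proof.
have rE (c : 'rV[D]_2) (B : 'M[D]_(2, n)) :
    c *m B = c 0 0 *: row 0 B + c 0 1 *: row 1 B.
  have lift1 : lift ord0 ord0 = 1 :> 'I_2 by apply/val_inj.
  by rewrite mulmx_sum_row big_ord_recl big_ord1 lift1.
pose pr c d : 'rV[D]_2 := row_of_seq 2 [:: c; d].
have prE c d (B : 'M[D]_(2, n)) : pr c d *m B = c *: row 0 B + d *: row 1 B.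
  by rewrite rE !mxE.
split=> [[B [Bfree ->]]|[x [y [x0 xy ->]]]].
  exists (row 0 B), (row 1 B); split.
  - apply/eqP => B0; have := Bfree (pr 1 0); rewrite prE B0 scaler0 scale0r addr0.
    by move=> /(_ erefl)/rowP/(_ 0)/eqP; rewrite !mxE oner_eq0.
  - move=> [c _ E]; have := Bfree (pr (- c) 1); rewrite prE -E scaleNr scale1r addNr.
    by move=> /(_ erefl)/rowP/(_ 1)/eqP; rewrite !mxE oner_eq0.
  apply/seteqP; split=> [_ [c _ <-]|_ [c [d ->]]].
    by exists (c 0 0), (c 0 1); rewrite rE.
  by exists (pr c d); rewrite ?prE.
pose B : 'M[D]_(2, n) := \matrix_(j < 2) (if j == 0 then x else y).
have B0 : row 0 B = x by rewrite rowK.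
have B1 : row 1 B = y by rewrite rowK.
exists B; split=> [c|].
  rewrite rE B0 B1 => cE.
  have c1 : c 0 1 = 0.
    apply: contra_notP xy => /eqP c1; exists (- ((c 0 1)^-1 * c 0 0)) => //.
    move/eqP: cE; rewrite addrC addr_eq0 => /eqP/(congr1 (fun v => (c 0 1)^-1 *: v)).
    by rewrite scalerA mulVr ?divD // scale1r => ->; rewrite scalerN scalerA scaleNr.
  move: cE; rewrite c1 scale0r addr0 => cx.
  have c0 : c 0 0 = 0.
    apply: contraNeq x0 => c0.
    by rewrite -[x]scale1r -(mulVr (divD c0)) -scalerA cx scaler0.
  apply/rowP => j; rewrite mxE; case: j => [[|[|//]]] lt_j.
    by rewrite -[RHS]c0; congr (c _ _); apply/val_inj.
  by rewrite -[RHS]c1; congr (c _ _); apply/val_inj.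
apply/seteqP; split=> [_ [c [d ->]]|_ [c _ <-]].
  by exists (pr c d); rewrite ?prE ?B0 ?B1.
by exists (c 0 0), (c 0 1); rewrite rE B0 B1.
Qed.

Lemma absolute_pointsE (f : 'rV[D]_n -> 'rV[D]_n -> D) :
  (forall c d x, f x x = 0 -> f (c *: x) (d *: x) = 0) ->
  absolute_points f = [set span1 x | x in [set x | x != 0 /\ f x x = 0]].
Proof.
move=> fZ; apply/seteqP; split=> [P [/is_subspace1P[x x0 ->] Pperp]|_ [x [x0 fx] <-]].
  by exists x => //; split=> //; apply: (Pperp x); apply: span1_id.
split; first by apply/is_subspace1P; exists x.
by move=> _ [d _ <-] _ [c _ <-]; apply: fZ.
Qed.

Lemma span2_mulmx (B : 'M[D]_n) x y v : mx_invertible B ->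
  span2 (x *m B) (y *m B) (v *m B) <-> span2 x y v.
Proof.
move=> [B' [BB' _]]; split=> -[c [d vE]]; exists c, d.
  by rewrite -[v]mulmx1 -BB' mulmxA vE mulmxDl -!scalemxAl -!mulmxA BB' !mulmx1.
by rewrite vE mulmxDl -!scalemxAl.
Qed.

Section Chart.
Variables (f : 'rV[D]_n -> 'rV[D]_n -> D) (K : Type) (A : set K).
Variable pt : K -> 'rV[D]_n.

Definition chart : Prop :=
  [/\ absolute_points f = [set span1 (pt k) | k in A],
      forall k, pt k != 0 & set_inj A (fun k => span1 (pt k))].

Definition join j k : set K := [set l | A l /\ span2 (pt j) (pt k) (pt l)].

Lemma blocksE : chart ->
  blocks f = [set b | exists j k, [/\ A j, A k, j <> k &
                       b = [set span1 (pt l) | l in join j k]]].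
Proof.
move=> [absE pt0 ptI].
have ponE j k : points_on f (span2 (pt j) (pt k)) = [set span1 (pt l) | l in join j k].
  rewrite /points_on absE; apply/seteqP; split=> [_ [[l Al <-] /span1_sub_span2 lL]|].
    by exists l.
  by move=> _ [l [Al lL] <-]; split; [exists l|apply/span1_sub_span2].
have indep j k : A j -> A k -> j <> k -> ~ span1 (pt j) (pt k).
  by move=> Aj Ak jk /span1_eq/(_ (pt0 k))/ptI; rewrite !in_setE => /(_ Aj Ak).
apply/seteqP; split=> [b [L [/is_subspace2P[x [y [x0 xy ->]]] -> [P [Q]]]]|b].
  rewrite /points_on absE => -[[[j Aj <-] /span1_sub_span2 jL]].
  move=> [[k Ak <-] /span1_sub_span2 kL] jk.
  have {}jk : j <> k by move=> E; rewrite E in jk.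
  exists j, k; split=> //.
  have LE : span2 x y = span2 (pt j) (pt k) by apply: span2_exchange => //; apply: indep.
  by rewrite -ponE /points_on absE LE.
move=> [j [k [Aj Ak jk ->]]]; exists (span2 (pt j) (pt k)); split.
- by apply/is_subspace2P; exists (pt j), (pt k); split=> //; apply: indep.
- by rewrite ponE.
exists (span1 (pt j)), (span1 (pt k)); split.
- by exists j => //; split; [|apply: span2_l].
- by exists k => //; split; [|apply: span2_r].
by move/ptI; rewrite !in_setE => /(_ Aj Ak).
Qed.
End Chart.
End DivisionRing.

(** Blocks are determined by the collinearity of triples of points, hence so is
    the isomorphism: transported to the labels, both families of blocks are the
    same family of subsets of A. *)
Lemma chart_incidence_iso (D D' : unitRingType) n n'
    (f : 'rV[D]_n -> 'rV[D]_n -> D) (f' : 'rV[D']_n' -> 'rV[D']_n' -> D')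
    (K : Type) (A : set K) (pt : K -> 'rV[D]_n) (pt' : K -> 'rV[D']_n')
    (eta : set 'rV[D]_n -> set 'rV[D']_n') :
  (forall c : D, c != 0 -> c \is a GRing.unit) ->
  (forall c : D', c != 0 -> c \is a GRing.unit) ->
  chart f A pt -> chart f' A pt' ->
  (forall k, A k -> eta (span1 (pt k)) = span1 (pt' k)) ->
  (forall j k l, A j -> A k -> A l -> j <> k ->
     span2 (pt j) (pt k) (pt l) <-> span2 (pt' j) (pt' k) (pt' l)) ->
  incidence_iso f f' eta.
Proof.
move=> div div' ch ch' etaE col.
have [absE _ ptI] := ch; have [absE' _ ptI'] := ch'.
have etaI : {in absolute_points f &, injective eta}.
  move=> P Q; rewrite !in_setE absE => -[j Aj <-] [k Ak <-].
  by rewrite !etaE // => /ptI' ->; rewrite ?in_setE.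
have joinE j k : A j -> A k -> j <> k -> join A pt j k = join A pt' j k.
  by move=> Aj Ak jk; apply/seteqP; split=> l [Al /col H]; split=> //; apply: H.
have etaB (J : set K) : J `<=` A ->
    [set eta P | P in [set span1 (pt l) | l in J]] = [set span1 (pt' l) | l in J].
  move=> JA; rewrite image_comp; apply: eq_imagel => l Jl /=.
  by rewrite etaE //; apply: JA.
have joinA j k : join A pt j k `<=` A by move=> l [].
split; split=> //.
- by move=> P; rewrite absE absE' => -[k Ak <-]; exists k; rewrite ?etaE.
- move=> Q; rewrite absE absE' => -[k Ak <-].
  by exists (span1 (pt k)); [exists k | rewrite etaE].
- move=> b; rewrite (blocksE div ch) (blocksE div' ch') => -[j [k [Aj Ak jk ->]]].
  by exists j, k; split=> //; rewrite etaB // joinE.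
- move=> b b'; rewrite !in_setE => hb hb'.
  have sub b0 : blocks f b0 -> b0 `<=` absolute_points f by case=> L [_ ->] _ P [].
  move=> E; apply/seteqP; split=> P bP.
    have: [set eta P | P in b'] (eta P) by rewrite -E; exists P.
    move=> [Q b'Q /etaI <- //]; rewrite in_setE; [exact: sub b'Q|exact: sub bP].
  have: [set eta P | P in b] (eta P) by rewrite E; exists P.
  move=> [Q b'Q /etaI <- //]; rewrite in_setE; [exact: sub b'Q|exact: sub bP].
move=> b; rewrite (blocksE div ch) (blocksE div' ch') => -[j [k [Aj Ak jk ->]]].
exists [set span1 (pt l) | l in join A pt j k]; first by exists j, k.
by rewrite etaB // joinE.
Qed.

(** * Projective classes and their products *)

Lemma PGL_act_span1 (D : unitRingType) n (v : 'rV[D]_n) (A : 'M[D]_n)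
    (hA : mx_invertible A) :
  PGL_act (span1 v) (mxclass hA) = span1 (v *m A).
Proof.
rewrite PGL_actE => [|c _ [d _ <-]]; last by exists (c * d); rewrite ?scalerA.
apply/seteqP; split=> [_ [_ [c _ <-] <-]|_ [c _ <-]].
  by exists c; rewrite // scalemxAl.
by exists (c *: v); [exists c | rewrite scalemxAl].
Qed.

Lemma mxclassM (D : unitRingType) n (A B E : 'M[D]_n) (hA : mx_invertible A)
    (hB : mx_invertible B) (hE : mx_invertible E) :
  A *m B = E -> (mxclass hA * mxclass hB)%g = mxclass hE.
Proof.
move=> AB; rewrite -[LHS]PGL_classM; congr PGL_class.
exact/val_inj.
Qed.

(** Stated for an operation on a bare set of labels: the group laws hold in G, and
    only closure and the behaviour of the unit and the inverses are asked for. *)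
Lemma image_group_closed (G : groupType) (K : Type) (A : set K)
    (mul : K -> K -> K) (one : K) (inv : K -> K) (F : K -> G) :
  A one -> (forall x, A x -> A (inv x)) -> (forall x y, A x -> A y -> A (mul x y)) ->
  mul one one = one -> (forall x, mul x (inv x) = one) ->
  (forall x y, (F x * F y)%g = F (mul x y)) ->
  group_closed [in [set F x | x in A]].
Proof.
move=> A1 AV AM mul11 mulV FM.
have F1 : F one = 1%g by apply: (mulgI (F one)); rewrite FM mul11 mulg1.
split=> [|_ _ /set_mem[x Ax <-] /set_mem[y Ay <-]]; first by apply/mem_set; exists one.
have -> : (F y)^-1%g = F (inv y).
  by apply: (mulgI (F y)); rewrite mulgV FM mulV F1.
by apply/mem_set; exists (mul x (inv y)); [apply: AM => //; apply: AV | rewrite FM].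
Qed.

(** * Conjugation and coordinates of quaternions *)

Section Geometry.
Variables (R : fieldType) (C : splittingFieldType R).
Variables (sigma : gal_of {:C}) (hsigma : quadratic_galois sigma).
Hypothesis char_R : 2%N \notin [pchar R].
Variables (i : C) (i_neq0 : i != 0) (i_sigma : sigma i = - i) (s : R).
Hypothesis anisotropic :
  forall a b : C, (a, b) != (0, 0) -> a * sigma a + s *: (b * sigma b) != 0.

Local Notation H := (quat s hsigma).
Implicit Types (a b c p q : C) (u v : C * C) (X Y Z : H).

Let sK : involutive sigma := conjKP hsigma.
Let S : C := s%:A.

Let SE a : s *: a = S * a. Proof. by rewrite mulr_algl. Qed.
Let sS : sigma S = S. Proof. by rewrite /S linearZ /= rmorph1. Qed.

Lemma two_neq0 : 2 != 0 :> C.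
Proof.
have -> : 2 = (2 : R)%:A :> C by rewrite scaler_nat.
by rewrite scaler_eq0 oner_eq0 orbF; move: char_R; rewrite inE.
Qed.
Let two0 := two_neq0.

Lemma sigma_half : sigma 2^-1 = 2^-1.
Proof. by rewrite fmorphV rmorph_nat. Qed.

Let sD a b : sigma (a + b) = sigma a + sigma b. Proof. exact: rmorphD. Qed.
Let sN a : sigma (- a) = - sigma a. Proof. exact: rmorphN. Qed.
Let sM a b : sigma (a * b) = sigma a * sigma b. Proof. exact: rmorphM. Qed.
Let s0 : sigma 0 = 0. Proof. exact: rmorph0. Qed.
Let s1 : sigma 1 = 1. Proof. exact: rmorph1. Qed.
Let sE := (sD, sN, sM, s0, s1, sK, sS, sigma_half).

(** The (-1)-eigenspace of sigma has R-dimension one: if it contained i and an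
    independent p, it would be all of C, which contains 1. *)
Lemma antifixedP p : (p \in <[i]>%VS) = (sigma p == - p).
Proof.
apply/idP/eqP => [/vlineP[k ->]|sp]; first by rewrite linearZ /= i_sigma scalerN.
apply: contra_neqT two0 => pNi; suff sN1 : sigma 1 = - 1.
  rewrite -[2]/(1 + 1) -[RHS](addNr 1); congr (_ + _).
  by rewrite -sN1 rmorph1.
have [dimC _ _] := hsigma.
have full : (<[i]> + <[p]>)%VS = {:C}%VS.
  apply/eqP; rewrite eqEdim subvf dimC dimv_disjoint_sum.
    by rewrite !dim_vline i_neq0; case: eqP pNi => // ->; rewrite mem0v.
  apply/eqP; rewrite -subv0; apply/subvP => v.
  rewrite memv_cap memv0 => /andP[vi /vlineP[k vE]]; rewrite vE.
  have [->|k0] := eqVneq k 0; first by rewrite scale0r.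
  by move: pNi; rewrite -[p]scale1r -(mulVf k0) -scalerA -vE memvZ.
have: 1 \in (<[i]> + <[p]>)%VS by rewrite full memvf.
move=> /memv_addP[_ /vlineP[k ->] [_ /vlineP[l ->] ->]].
by rewrite raddfD /= !linearZ /= i_sigma sp !scalerN opprD.
Qed.

Lemma quat_eq X Y : qa X = qa Y -> qb X = qb Y -> X = Y.
Proof. by move=> eqa eqb; rewrite -[X]of_pairK -[Y]of_pairK eqa eqb. Qed.

Lemma qaD X Y : qa (X + Y) = qa X + qa Y. Proof. by rewrite /qa mxE. Qed.
Lemma qbD X Y : qb (X + Y) = qb X + qb Y. Proof. by rewrite /qb mxE rmorphD. Qed.
Lemma qaN X : qa (- X) = - qa X. Proof. by rewrite /qa mxE. Qed.
Lemma qbN X : qb (- X) = - qb X. Proof. by rewrite /qb mxE rmorphN. Qed.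
Lemma qa0 : qa (0 : H) = 0. Proof. by rewrite /qa mxE. Qed.
Lemma qb0 : qb (0 : H) = 0. Proof. by rewrite /qb mxE rmorph0. Qed.
Lemma qa1 : qa (1 : H) = 1. Proof. by rewrite /qa mxE. Qed.
Lemma qb1 : qb (1 : H) = 0. Proof. by rewrite /qb mxE rmorph0. Qed.

Lemma qaM X Y : qa (X * Y) = qa X * qa Y - S * (sigma (qb X) * qb Y).
Proof. by rewrite -{1}[X]of_pairK -{1}[Y]of_pairK of_pairM qaE SE. Qed.

Lemma qbM X Y : qb (X * Y) = sigma (qa X) * qb Y + qb X * qa Y.
Proof. by rewrite -{1}[X]of_pairK -{1}[Y]of_pairK of_pairM qbE. Qed.

Lemma qa_alpha X : qa (qalpha X) = sigma (qa X). Proof. exact: qaE. Qed.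
Lemma qb_alpha X : qb (qalpha X) = qb X. Proof. exact: qbE. Qed.
Lemma qa_emb c : qa (emb s hsigma c) = c. Proof. by rewrite /qa mxE. Qed.

Lemma qb_emb c : qb (emb s hsigma c) = 0.
Proof. by rewrite /qb mxE /= rmorph0. Qed.

Lemma half_quat : 2^-1 = emb s hsigma 2^-1.
Proof.
set e := emb _ _ _.
have e2 : e * 2 = 1.
  apply: quat_eq; rewrite ?(qaM, qbM, qaD, qbD, qa1, qb1, qa_emb, qb_emb).
    by rewrite !(rmorph0, mul0r, mulr0, subr0) mulVf.
  by rewrite !(mulr0, mul0r, addr0).
have u2 : (2 : H) \is a GRing.unit.
  by apply/unitrP; exists e; split=> //; rewrite mulr_natl -mulr_natr.
by apply: (mulIr u2); rewrite mulVr.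
Qed.

Lemma qa_half : qa (2^-1 : H) = 2^-1. Proof. by rewrite half_quat qa_emb. Qed.
Lemma qb_half : qb (2^-1 : H) = 0. Proof. by rewrite half_quat qb_emb. Qed.

(** Conjugation of X by i: it fixes C and sends w to - w. *)
Definition twist X : H := of_pair s hsigma (qa X, - qb X).

Lemma qa_twist X : qa (twist X) = qa X. Proof. exact: qaE. Qed.
Lemma qb_twist X : qb (twist X) = - qb X. Proof. exact: qbE. Qed.

(* The rules for compound constants precede those for sums and products, which
   would otherwise match the bodies of these constants. *)
Let qE := (qa_twist, qb_twist, qaE, qbE, qa_alpha, qb_alpha,
           qa_emb, qb_emb, qa_half, qb_half, qaD, qbD, qaN, qbN, qa0, qb0,
           qa1, qb1, qaM, qbM).

Lemma qalphaD X Y : qalpha (X + Y) = qalpha X + qalpha Y.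
Proof. by apply: quat_eq; rewrite !qE ?sE. Qed.

Lemma qalphaM X Y : qalpha (X * Y) = qalpha Y * qalpha X.
Proof. by apply: quat_eq; rewrite !qE ?sE; ring. Qed.

Lemma qalpha_eq0 X : qalpha X = 0 -> X = 0.
Proof.
move=> aX; apply: quat_eq; rewrite !qE.
  by rewrite -[LHS]sK -qa_alpha aX qa0 rmorph0.
by rewrite -qb_alpha aX qb0.
Qed.

Lemma quat_unit X : X != 0 -> X \is a GRing.unit.
Proof. exact: quat_division. Qed.

Lemma quat_mulf_eq0 X Y : X * Y = 0 -> X = 0 \/ Y = 0.
Proof.
move=> XY0; have [->|/quat_unit uX] := eqVneq X 0; [by left | right].
by rewrite -[Y](mulKr uX) XY0 mulr0.
Qed.

Lemma xi_entryE u p :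
  xi_entry s hsigma u p = p - 2^-1 * (u.1 * sigma u.1 + S * (u.2 * sigma u.2)).
Proof. by rewrite /xi_entry /qnorm !qE SE. Qed.

Lemma qa_psi_entry X p : qa (psi_entry X p) =
  p - 2^-1 * (qa X * sigma (qa X) - S * (sigma (qb X) * qb X)).
Proof. by rewrite /psi_entry !qE ?sE; ring. Qed.

Lemma qb_psi_entry X p : qb (psi_entry X p) = - (sigma (qa X) * qb X).
Proof. by rewrite /psi_entry !qE ?sE; field. Qed.

Let qEE := (qa_psi_entry, qb_psi_entry, xi_entryE, qE).

(** The identity that turns left multiples over H into left multiples over C.
    With X = u_0 + w u_1 it follows from X^alpha X~ = N(X) and p X~ = X p, where
    the latter uses that p is a multiple of i. *)
Lemma psi_entry_twist u p : sigma p = - p ->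
  psi_entry (of_pair s hsigma u) p * twist (of_pair s hsigma u) =
  of_pair s hsigma u * emb s hsigma (xi_entry s hsigma u p).
Proof. by move=> sp; apply: quat_eq; rewrite !qEE ?sE /= ?sp; field. Qed.

Lemma twistK : involutive twist.
Proof. by move=> X; apply: quat_eq; rewrite !qE ?opprK. Qed.

Lemma twist_eq0 X : twist X = 0 -> X = 0.
Proof.
by move=> tX; rewrite -[X]twistK tX; apply: quat_eq; rewrite !qE ?oppr0.
Qed.

Lemma twistM_emb X c : twist (X * emb s hsigma c) = twist X * emb s hsigma c.
Proof. by apply: quat_eq; rewrite !qE ?sE /=; ring. Qed.

(** * The common parameter group *)

Definition herm u v : C := u.1 * sigma v.1 + S * (u.2 * sigma v.2).

Definition param : Type := (C * C) * C.
Implicit Types (x y z : param) (k l : option param).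

(** The law for which both families of matrices are multiplicative; its last
    term makes up for the non-symmetry of the hermitian product, as the last
    coordinates involve only the symmetric quantity N(u + v). *)
Definition pmul x y : param :=
  ((x.1.1 + y.1.1, x.1.2 + y.1.2),
   x.2 + y.2 - 2^-1 * (herm x.1 y.1 - sigma (herm x.1 y.1))).
Definition pone : param := ((0, 0), 0).
Definition pinv x : param := ((- x.1.1, - x.1.2), - x.2).

Definition params : set param := [set x | x.2 \in <[i]>%VS].

Lemma paramsP x : params x <-> sigma x.2 = - x.2.
Proof. by rewrite /params /= antifixedP; split=> /eqP. Qed.

Lemma params1 : params pone. Proof. exact: mem0v. Qed.

Lemma paramsV x : params x -> params (pinv x).
Proof. by rewrite /params /= memvN. Qed.

Lemma paramsM x y : params x -> params y -> params (pmul x y).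
Proof.
by rewrite !paramsP /= => sx sy; rewrite /herm ?sE /= sx sy; ring.
Qed.

Lemma pmulV x : pmul x (pinv x) = pone.
Proof.
by congr ((_, _), _); rewrite /= ?subrr // /herm /= ?sE; ring.
Qed.

Lemma pmul11 : pmul pone pone = pone.
Proof.
by congr ((_, _), _); rewrite /= ?addr0 // /herm /= ?sE; ring.
Qed.

Definition xi_par x : 'M[C]_4 := xi_mx s hsigma x.1 x.2.
Definition psi_par x : 'M[H]_3 := psi_mx (of_pair s hsigma x.1) x.2.

Lemma xi_entryM x y :
  xi_entry s hsigma y.1 y.2 - herm x.1 y.1 + xi_entry s hsigma x.1 x.2 =
  xi_entry s hsigma (pmul x y).1 (pmul x y).2.
Proof. by rewrite !xi_entryE /= /herm ?sE; field. Qed.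

(** Agrees with [xi_entryM] because the w-components of X Y^alpha and Y X^alpha
    coincide, so their difference lies in C, where it is <u, v> - <v, u>. *)
Lemma psi_entryM x y (X := of_pair s hsigma x.1) (Y := of_pair s hsigma y.1) :
  psi_entry Y y.2 - X * qalpha Y + psi_entry X x.2 =
  psi_entry (of_pair s hsigma (pmul x y).1) (pmul x y).2.
Proof.
by apply: quat_eq; rewrite !qEE /= /herm ?sE; field.
Qed.

Lemma of_pairD u v :
  of_pair s hsigma (u.1 + v.1, u.2 + v.2) = of_pair s hsigma u + of_pair s hsigma v.
Proof. by apply: quat_eq; rewrite !qE /=. Qed.

Lemma xi_parM x y : xi_par x *m xi_par y = xi_par (pmul x y).
Proof.
apply/matrixP => m n; rewrite !mxE !big_ord_recl big_ord0 !mxE /=.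
case: m => [[|[|[|[|//]]]] ?]; case: n => [[|[|[|[|//]]]] ?];
  rewrite /= ?(mul1r, mulr1, mul0r, mulr0, addr0, add0r) //.
- exact: addrC.
- exact: addrC.
- by rewrite -xi_entryM addrA addrA mulrN SE /herm; ring.
- by rewrite sD opprD addrC.
by rewrite sD scalerDr opprD addrC.
Qed.

Lemma psi_parM x y : psi_par x *m psi_par y = psi_par (pmul x y).
Proof.
apply/matrixP => m n; rewrite !mxE !big_ord_recl big_ord0 !mxE /=.
case: m => [[|[|[|//]]] ?]; case: n => [[|[|[|//]]] ?];
  rewrite /= ?(mul1r, mulr1, mul0r, mulr0, addr0, add0r) //.
- by rewrite of_pairD addrC.
- by rewrite -psi_entryM addrA mulrN.
by rewrite of_pairD qalphaD [RHS]opprD addrC.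
Qed.

(** * The absolute points of the two forms *)

(** The label None stands for the point at infinity. *)
Definition pt_g k : 'rV[C]_4 := match k with
  | None => row_of_seq 4 [:: 0; 0; 0; 1]
  | Some x => row_of_seq 4 [:: 1; x.1.1; x.1.2; xi_entry s hsigma x.1 x.2]
  end.

Definition pt_h k : 'rV[H]_3 := match k with
  | None => row_of_seq 3 [:: 0; 0; 1]
  | Some x => row_of_seq 3 [:: 1; of_pair s hsigma x.1;
                              psi_entry (of_pair s hsigma x.1) x.2]
  end.

Definition pts : set (option param) := [set k | if k is Some x then params x else True].

Lemma eq_row4 (T : Type) (v w : 'rV[T]_4) :
  v 0 0 = w 0 0 -> v 0 1 = w 0 1 -> v 0 2 = w 0 2 -> v 0 3 = w 0 3 -> v = w.
Proof.
move=> e0 e1 e2 e3; apply/rowP => -[[|[|[|[|//]]]] lt_j].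
- by have -> : Ordinal lt_j = 0 by apply/val_inj.
- by have -> : Ordinal lt_j = 1 by apply/val_inj.
- by have -> : Ordinal lt_j = 2 by apply/val_inj.
by have -> : Ordinal lt_j = 3 by apply/val_inj.
Qed.

Lemma eq_row3 (T : Type) (v w : 'rV[T]_3) :
  v 0 0 = w 0 0 -> v 0 1 = w 0 1 -> v 0 2 = w 0 2 -> v = w.
Proof.
move=> e0 e1 e2; apply/rowP => -[[|[|[|//]]] lt_j].
- by have -> : Ordinal lt_j = 0 by apply/val_inj.
- by have -> : Ordinal lt_j = 1 by apply/val_inj.
by have -> : Ordinal lt_j = 2 by apply/val_inj.
Qed.

Definition trans x k : option param := omap (pmul^~ x) k.

(** Each finite point is the first row of the matrix with the same parameter, so
    the matrix product already computes the action on points. *)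
Lemma pt_g_row x k : pt_g (trans x k) = pt_g k *m xi_par x.
Proof.
case: k => [y|].
  have rowE z : pt_g (Some z) = row 0 (xi_par z) by apply: eq_row4; rewrite !mxE.
  by rewrite [trans _ _]/= !rowE -xi_parM row_mul.
have -> : pt_g None = row 3 (1%:M) :> 'rV[C]_4.
  by apply: eq_row4; rewrite !mxE.
by rewrite /= -row_mul mul1mx; apply: eq_row4; rewrite !mxE.
Qed.

Lemma pt_h_row x k : pt_h (trans x k) = pt_h k *m psi_par x.
Proof.
case: k => [y|].
  have rowE z : pt_h (Some z) = row 0 (psi_par z) by apply: eq_row3; rewrite !mxE.
  by rewrite [trans _ _]/= !rowE -psi_parM row_mul.
have -> : pt_h None = row 2 (1%:M) :> 'rV[H]_3.
  by apply: eq_row3; rewrite !mxE.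
by rewrite /= -row_mul mul1mx; apply: eq_row3; rewrite !mxE.
Qed.

Lemma pt_g_neq0 k : pt_g k != 0.
Proof.
case: k => [x|]; apply/eqP => /rowP; last by move/(_ 3)/eqP; rewrite !mxE oner_eq0.
by move/(_ 0)/eqP; rewrite !mxE oner_eq0.
Qed.

Lemma pt_h_neq0 k : pt_h k != 0.
Proof.
case: k => [x|]; apply/eqP => /rowP; last by move/(_ 2)/eqP; rewrite !mxE oner_eq0.
by move/(_ 0)/eqP; rewrite !mxE oner_eq0.
Qed.

Lemma emb_inj : injective (emb s hsigma).
Proof. by move=> a b /(congr1 (@qa _ _ _ _ _)); rewrite !qa_emb. Qed.

Lemma of_pair_inj : injective (of_pair s hsigma).
Proof.
move=> [a b] [c d] e; have := congr1 (@qa _ _ _ _ _) e.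
by have := congr1 (@qb _ _ _ _ _) e; rewrite !qE /= => -> ->.
Qed.

Lemma pt_g_inj : injective (fun k => span1 (pt_g k)).
Proof.
move=> k l e; have : span1 (pt_g k) (pt_g l) by rewrite e; apply: span1_id.
case: k l {e} => [x|] [y|] // [c _ /rowP cE]; last 2 first.
- by have /eqP := cE 0; rewrite !mxE /= mulr1 => /eqP c0; have /eqP := cE 3;
    rewrite !mxE /= c0 mul0r eq_sym oner_eq0.
- by have /eqP := cE 0; rewrite !mxE /= mulr0 eq_sym oner_eq0.
have c1 : c = 1 by have := cE 0; rewrite !mxE /= mulr1.
move: (cE 1) (cE 2) (cE 3); rewrite !mxE /= c1 !mul1r {cE}.
case: x y => [[u0 u1] p] [[v0 v1] q] /= -> ->.
by move/addIr => ->.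
Qed.

Lemma pt_h_inj : injective (fun k => span1 (pt_h k)).
Proof.
move=> k l e; have : span1 (pt_h k) (pt_h l) by rewrite e; apply: span1_id.
case: k l {e} => [x|] [y|] // [c _ /rowP cE]; last 2 first.
- by have /eqP := cE 0; rewrite !mxE /= mulr1 => /eqP c0; have /eqP := cE 2;
    rewrite !mxE /= c0 mul0r eq_sym oner_eq0.
- by have /eqP := cE 0; rewrite !mxE /= mulr0 eq_sym oner_eq0.
have c1 : c = 1 by have := cE 0; rewrite !mxE /= mulr1.
move: (cE 1) (cE 2); rewrite !mxE /= c1 !mul1r {cE}.
case: x y => [u p] [v q] /= /of_pair_inj ->.
by move/addIr/emb_inj => ->.
Qed.

Lemma field_unit c : c != 0 -> c \is a GRing.unit.
Proof. by rewrite unitfE. Qed.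

Lemma g_scale c a (v : 'rV[C]_4) :
  g sigma s (c *: v) (a *: v) = c * sigma a * g sigma s v v.
Proof. by rewrite /g !mxE !SE !sM; ring. Qed.

Lemma h_scale (c a : H) (V : 'rV[H]_3) :
  h s hsigma (c *: V) (a *: V) = c * h s hsigma V V * qalpha a.
Proof.
rewrite /h !mxE !qalphaM.
move: (qalpha (V 0 0)) (qalpha (V 0 1)) (qalpha (V 0 2)) (qalpha a) => A0 A1 A2 a'.
by rewrite !mulrDr !mulrDl !mulrA.
Qed.

(** A vector with first coordinate 0 is absolute only if its middle part has norm
    0, so by anisotropy it spans infinity; with first coordinate 1, the equation
    says that the last coordinate plus N / 2 is anti-fixed by sigma. *)
Lemma g_chart : chart (g sigma s) pts pt_g.
Proof.
split; [|exact: pt_g_neq0|by move=> k l _ _; apply: pt_g_inj].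
rewrite (absolute_pointsE field_unit); last by move=> c a v v0; rewrite g_scale v0 mulr0.
apply/seteqP; split=> [_ [v [v0 gv] <-]|_ [k kP <-]]; last first.
  exists (pt_g k) => //; split; first exact: pt_g_neq0.
  case: k kP => [x /paramsP sx|_]; rewrite /g !mxE /= ?SE ?xi_entryE ?sE ?sx.
    by field.
  by ring.
have [v00|v00] := eqVneq (v 0 0) 0.
  have [v1 v2] : v 0 1 = 0 /\ v 0 2 = 0.
    apply/pair_equal_spec/eqP/(contraTT (@anisotropic _ _)).
    by move: gv; rewrite /g v00 s0 mul0r mulr0 !add0r => ->; rewrite eqxx.
  exists None => //; have vE : v = v 0 3 *: pt_g None.
    by apply: eq_row4; rewrite !mxE /= ?mulr0 ?mulr1.
  by rewrite [in RHS]vE (span1Z field_unit) //;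
    apply: contraNneq v0 => v3; rewrite vE v3 scale0r.
set w := (v 0 0)^-1 *: v; have w0 : w 0 0 = 1 by rewrite mxE mulVf.
have gw : g sigma s w w = 0 by rewrite g_scale gv mulr0.
pose x : param := ((w 0 1, w 0 2),
  w 0 3 + 2^-1 * (w 0 1 * sigma (w 0 1) + S * (w 0 2 * sigma (w 0 2)))).
exists (Some x).
  apply/paramsP; move: gw; rewrite /g w0 SE s1 mul1r mulr1 /x /= !sE => gw.
  apply/eqP; rewrite -subr_eq0 -gw; apply/eqP; field.
  exact: two0.
have -> : pt_g (Some x) = w.
  by apply: eq_row4; rewrite [LHS]mxE /= ?w0 // xi_entryE addrK.
by rewrite (span1Z field_unit) ?invr_neq0.
Qed.

(** alpha fixes X X^alpha and the elements of w C, so Y + X X^alpha / 2 has no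
    w-component and its C-component is anti-fixed by sigma. *)
Lemma psi_entry_complete X Y : qalpha Y + X * qalpha X + Y = 0 ->
  exists2 p, sigma p = - p & Y = psi_entry X p.
Proof.
move=> e; have ea := congr1 (@qa _ _ _ _ _) e; have eb := congr1 (@qb _ _ _ _ _) e.
move: ea eb; rewrite !qE => ea eb.
pose p := qa Y + 2^-1 * (qa X * sigma (qa X) - S * (sigma (qb X) * qb X)).
exists p.
  (* Abstracted because qb X is itself a conjugate, to which sK would apply. *)
  rewrite /p; move: ea; move: (qa X) (qb X) (qa Y) => a b c ea.
  by apply/eqP; rewrite !sE -subr_eq0 -ea; apply/eqP; field.
apply: quat_eq; rewrite !qEE; first by rewrite /p addrK.
apply/(mulfI two0)/eqP; rewrite -subr_eq0 -eb; apply/eqP; ring.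
Qed.

Lemma h_chart : chart (h s hsigma) pts pt_h.
Proof.
split; [|exact: pt_h_neq0|by move=> k l _ _; apply: pt_h_inj].
rewrite (absolute_pointsE quat_unit); last first.
  by move=> c a v v0; rewrite h_scale v0 mulr0 mul0r.
apply/seteqP; split=> [_ [V [V0 hV] <-]|_ [k kP <-]]; last first.
  exists (pt_h k) => //; split; first exact: pt_h_neq0.
  case: k kP => [x /paramsP sx|_]; rewrite /h !mxE /=.
    by apply: quat_eq; rewrite !qEE ?sE ?sx; field.
  by apply: quat_eq; rewrite !qE ?sE; ring.
have [V00|V00] := eqVneq (V 0 0) 0.
  have V1 : V 0 1 = 0.
    move: hV; rewrite /h V00 mul0r add0r.
    have -> : qalpha (0 : H) = 0 by apply: quat_eq; rewrite !qE ?sE.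
    by rewrite mulr0 addr0 => /quat_mulf_eq0[|/qalpha_eq0].
  exists None => //; have VE : V = V 0 2 *: pt_h None.
    by apply: eq_row3; rewrite !mxE /= ?mulr0 ?mulr1.
  by rewrite [in RHS]VE (span1Z quat_unit) //;
    apply: contraNneq V0 => V2; rewrite VE V2 scale0r.
set W := (V 0 0)^-1 *: V; have W0 : W 0 0 = 1 by rewrite mxE mulVr ?quat_unit.
have hW : h s hsigma W W = 0 by rewrite h_scale hV mulr0 mul0r.
set X := W 0 1; set Q := W 0 2.
have {}hW : qalpha Q + X * qalpha X + Q = 0.
  have a1 : qalpha (1 : H) = 1 by apply: quat_eq; rewrite !qE ?sE.
  by rewrite -hW /h W0 a1 mul1r mulr1.
have [p sp QE] := psi_entry_complete hW.
have XE : of_pair s hsigma (qa X, qb X) = X by apply: of_pairK.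
exists (Some ((qa X, qb X), p)); first by apply/paramsP.
have -> : pt_h (Some ((qa X, qb X), p)) = W.
  by apply: eq_row3; rewrite [LHS]mxE /= ?XE ?W0 -?QE.
by rewrite (span1Z quat_unit) //;
  apply: contraNneq V00 => iV; rewrite -[V 0 0]invrK iV invr0.
Qed.

(** * Collinearity *)

Lemma pt_g_origin : pt_g (Some pone) = row_of_seq 4 [:: 1; 0; 0; 0].
Proof. by apply: eq_row4; rewrite !mxE //= xi_entryE /=; ring. Qed.

Lemma of_pair0 : of_pair s hsigma (0, 0) = 0.
Proof. by apply: quat_eq; rewrite !qE. Qed.

Lemma xi_entry0 p : xi_entry s hsigma (0, 0) p = p.
Proof. by rewrite xi_entryE /=; ring. Qed.

Lemma psi_entry0 p : psi_entry (0 : H) p = emb s hsigma p.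
Proof. by apply: quat_eq; rewrite !qEE ?sE /=; ring. Qed.

Lemma pt_h_origin : pt_h (Some pone) = row_of_seq 3 [:: 1; 0; 0].
Proof.
apply: eq_row3; rewrite !mxE //= of_pair0 ?psi_entry0 //.
by apply: quat_eq; rewrite !qE.
Qed.

(** Adding the entry to its conjugate gives - N(u), so a zero entry forces u = 0,
    and then the entry is p. *)
Lemma xi_entry_neq0 x : params x -> x <> pone -> xi_entry s hsigma x.1 x.2 != 0.
Proof.
case: x => [[a b] p] /paramsP /= sp x1; apply/eqP => e.
have N0 : a * sigma a + s *: (b * sigma b) = 0.
  have := congr1 sigma e; rewrite xi_entryE !sE /= sp => e'.
  have := congr2 +%R e e'; rewrite xi_entryE /= SE => e2.
  by apply: oppr_inj; rewrite oppr0 -[RHS](addr0 0) -e2; field.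
have /pair_equal_spec[a0 b0] : (a, b) = (0, 0).
  by apply/eqP/(contraTT (@anisotropic _ _)); rewrite N0 eqxx.
by apply: x1; move: e; rewrite a0 b0 xi_entry0 => ->.
Qed.

(** Collinearity with the origin (1, 0, 0): the third point is obtained from the
    second by a left factor on all coordinates except the first. *)
Definition g_multiple x y := exists c,
  [/\ y.1.1 = c * x.1.1, y.1.2 = c * x.1.2 &
      xi_entry s hsigma y.1 y.2 = c * xi_entry s hsigma x.1 x.2].

Definition h_multiple x y := exists c : H,
  of_pair s hsigma y.1 = c * of_pair s hsigma x.1 /\
  psi_entry (of_pair s hsigma y.1) y.2 = c * psi_entry (of_pair s hsigma x.1) x.2.

Lemma emb_neq0 c : c != 0 -> emb s hsigma c != 0.
Proof.
by apply: contraNneq => /(congr1 (@qa _ _ _ _ _)); rewrite qa_emb qa0 => ->.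
Qed.

Lemma of_pair_neq0 u : u <> (0, 0) -> of_pair s hsigma u != 0.
Proof. by move=> u0; apply/eqP; rewrite -of_pair0 => /of_pair_inj. Qed.

Lemma of_pair_scale c u :
  of_pair s hsigma (c * u.1, c * u.2) = of_pair s hsigma u * emb s hsigma c.
Proof. by apply: quat_eq; rewrite !qE ?sE /=; ring. Qed.

Lemma embM a b : emb s hsigma (a * b) = emb s hsigma a * emb s hsigma b.
Proof. by apply: quat_eq; rewrite !qE ?sE /=; ring. Qed.

(** Write X, Y for the quaternions of x and y, and e for the entries over C.  If
    Y = X c, as is the case for the coordinates c u, then X c X^-1 is the factor
    over H: multiplied by X~ c on the right, both the entry of y and X c X^-1 times
    the entry of x become X c e(y), by [psi_entry_twist].  Conversely, if
    Y = c X and the entries over H have the same ratio c, the same identity yields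
    Y~ = X~ d with d = e(y) / e(x), hence
    Y = X d, and d is the factor over C. *)
Lemma multipleE x y : params x -> params y -> x <> pone ->
  g_multiple x y <-> h_multiple x y.
Proof.
move=> xP yP x1; have ex := xi_entry_neq0 xP x1.
move/paramsP: xP => sx; move/paramsP: yP => sy.
have Tx := psi_entry_twist x.1 sx; have Ty := psi_entry_twist y.1 sy.
case: x y x1 sx sy ex Tx Ty => [u p] [v q] /= x1 sp sq ex Tx Ty.
(* For u = 0, when X is not invertible, either relation forces v = 0. *)
have [u0|u0] := EM (u = (0, 0)).
  rewrite /g_multiple /h_multiple u0 /= of_pair0 !xi_entry0 psi_entry0.
  have p0 : p != 0 by move: ex; rewrite u0 xi_entry0.
  split=> [[c [v1 v2 eq]]|[c [v0 eq]]].
    have {v1 v2} v0 : v = (0, 0) by rewrite [v]surjective_pairing v1 v2 !mulr0.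
    exists (emb s hsigma c); rewrite v0 of_pair0 mulr0 psi_entry0; split=> //.
    by move: eq; rewrite v0 xi_entry0 => ->; rewrite embM.
  have {}v0 : v = (0, 0) by apply: of_pair_inj; rewrite v0 mulr0 of_pair0.
  by exists (q / p); rewrite v0 xi_entry0 !mulr0 mulfVK.
have X0 := of_pair_neq0 u0; set X := of_pair s hsigma u in X0 Tx *.
have uX := quat_unit X0.
have utX : twist X \is a GRing.unit.
  by apply: quat_unit; apply: contraNneq X0 => /twist_eq0 ->.
rewrite /g_multiple /h_multiple /= -/X; set Y := of_pair s hsigma v in Ty *.
set E := xi_entry s hsigma u p in ex Tx *; set F := xi_entry s hsigma v q in Ty *.
split=> [[c [v1 v2 EF]]|[c [YE PE]]].
  have YE : Y = X * emb s hsigma c by rewrite /Y [v]surjective_pairing v1 v2 of_pair_scale.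
  have [c0|c0] := eqVneq c 0.
    have v0 : v = (0, 0) by rewrite [v]surjective_pairing v1 v2 c0 !mul0r.
    exists 0; rewrite !mul0r /Y v0 of_pair0 psi_entry0; split=> //.
    move: EF; rewrite c0 mul0r /F v0 xi_entry0 => ->.
    by apply: quat_eq; rewrite !qE.
  have uc : emb s hsigma c \is a GRing.unit by apply/quat_unit/emb_neq0.
  exists (X * emb s hsigma c * X^-1); split; first by rewrite mulrVK.
  apply: (mulIr utX); apply: (mulIr uc).
  rewrite -[LHS]mulrA -twistM_emb -YE Ty -[_ * twist X]mulrA Tx.
  by rewrite YE EF -!mulrA mulKr // -!embM (mulrC E).
have uE : emb s hsigma E \is a GRing.unit by apply/quat_unit/emb_neq0.
have [Y0|Y0] := eqVneq Y 0.
  have c0 : c = 0 by case/esym/quat_mulf_eq0: (etrans (esym Y0) YE) => //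
    /eqP; rewrite (negbTE X0).
  have v0 : v = (0, 0) by apply: of_pair_inj; rewrite of_pair0.
  exists 0; rewrite !mul0r v0; split=> //; apply: emb_inj.
  move: PE; rewrite c0 mul0r Y0 psi_entry0 /F v0 xi_entry0 => ->.
  by apply: quat_eq; rewrite !qE.
set d := E^-1 * F; have dE : E * d = F by rewrite mulrA mulfV ?mul1r.
have PX : psi_entry Y q * twist X = Y * emb s hsigma E.
  by rewrite PE -mulrA Tx mulrA -YE.
have P0 : psi_entry Y q != 0.
  by apply: contra_neq Y0 => P0; apply: (mulIr uE); rewrite -PX P0 !mul0r.
have tYE : twist Y = twist X * emb s hsigma d.
  by apply: (mulrI (quat_unit P0)); rewrite Ty mulrA PX -mulrA -embM dE.
have : Y = of_pair s hsigma (d * u.1, d * u.2).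
  by rewrite of_pair_scale -[LHS]twistK tYE -twistM_emb twistK.
by move=> /of_pair_inj vE; exists d; split; [rewrite vE|rewrite vE|rewrite mulrC dE].
Qed.

Lemma span2_origin_g x k : params x -> x <> pone ->
  span2 (pt_g (Some pone)) (pt_g (Some x)) (pt_g k) <->
  if k is Some y then g_multiple x y else x.1 = (0, 0).
Proof.
move=> xP x1; rewrite pt_g_origin; case: k => [y|]; split=> [[c [d /rowP vE]]|].
- by exists d; split; [move: (vE 1)|move: (vE 2)|move: (vE 3)];
    rewrite !mxE /= mulr0 add0r.
- move=> [d [y1 y2 e]]; exists (1 - d), d.
  by apply: eq_row4; rewrite !mxE /= ?mulr0 ?add0r // !mulr1 addrNK.
- have d0 : d != 0.
    by apply: contra_eqN (vE 3) => /eqP->; rewrite !mxE /= mulr0 mul0r addr0 oner_neq0.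
  move: (vE 1) (vE 2); rewrite !mxE /= mulr0 !add0r.
  move=> /esym/eqP; rewrite mulf_eq0 (negbTE d0) /= => /eqP a0.
  move=> /esym/eqP; rewrite mulf_eq0 (negbTE d0) /= => /eqP b0.
  by rewrite [x.1]surjective_pairing a0 b0.
move=> x0; have := xi_entry_neq0 xP x1; rewrite x0 xi_entry0 => p0.
exists (- x.2^-1), x.2^-1.
by apply: eq_row4; rewrite !mxE /= ?x0 ?xi_entry0 /= ?mulr0 ?add0r ?mulr1 ?addNr ?mulVf.
Qed.

Lemma span2_origin_h x k : params x -> x <> pone ->
  span2 (pt_h (Some pone)) (pt_h (Some x)) (pt_h k) <->
  if k is Some y then h_multiple x y else x.1 = (0, 0).
Proof.
move=> xP x1; rewrite pt_h_origin; case: k => [y|]; split=> [[c [d /rowP vE]]|].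
- by exists d; split; [move: (vE 1)|move: (vE 2)]; rewrite !mxE /= mulr0 add0r.
- move=> [d [y1 e]]; exists (1 - d), d.
  by apply: eq_row3; rewrite !mxE /= ?mulr0 ?add0r // !mulr1 addrNK.
- have d0 : d != 0.
    by apply: contra_eqN (vE 2) => /eqP->; rewrite !mxE /= mulr0 mul0r addr0 oner_neq0.
  move: (vE 1); rewrite !mxE /= mulr0 !add0r => /esym/quat_mulf_eq0[/eqP|x0].
    by rewrite (negbTE d0).
  by apply: of_pair_inj; rewrite x0 of_pair0.
move=> x0; have := xi_entry_neq0 xP x1; rewrite x0 xi_entry0 => /emb_neq0/quat_unit up.
exists (- (emb s hsigma x.2)^-1), (emb s hsigma x.2)^-1.
by apply: eq_row3; rewrite !mxE /= ?x0 ?of_pair0 ?psi_entry0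
  ?mulr0 ?add0r ?mulr1 ?addNr ?mulVr.
Qed.

Lemma span2_infty_g k :
  span2 (pt_g (Some pone)) (pt_g None) (pt_g k) <->
  if k is Some y then y.1 = (0, 0) else True.
Proof.
case: k => [y|]; last by split=> // _; apply: span2_r.
rewrite pt_g_origin; split=> [[c [d /rowP vE]]|y0].
  move: (vE 1) (vE 2); rewrite !mxE /= !mulr0 addr0 => a0 b0.
  by rewrite [y.1]surjective_pairing a0 b0.
exists 1, (xi_entry s hsigma y.1 y.2).
by apply: eq_row4; rewrite !mxE /= ?y0 /= ?mulr0 ?mulr1 ?addr0 ?add0r.
Qed.

Lemma span2_infty_h k :
  span2 (pt_h (Some pone)) (pt_h None) (pt_h k) <->
  if k is Some y then y.1 = (0, 0) else True.
Proof.
case: k => [y|]; last by split=> // _; apply: span2_r.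
rewrite pt_h_origin; split=> [[c [d /rowP vE]]|y0].
  move: (vE 1); rewrite !mxE /= !mulr0 addr0 => a0.
  by apply: of_pair_inj; rewrite a0 of_pair0.
exists 1, (psi_entry (of_pair s hsigma y.1) y.2).
by apply: eq_row3; rewrite !mxE /= ?y0 ?of_pair0 ?mulr0 ?mulr1 ?addr0 ?add0r.
Qed.

Lemma collinear_origin k l : pts k -> pts l -> k <> Some pone ->
  span2 (pt_g (Some pone)) (pt_g k) (pt_g l) <->
  span2 (pt_h (Some pone)) (pt_h k) (pt_h l).
Proof.
case: k => [x|] xP lP kN; last by rewrite span2_infty_g span2_infty_h.
have x1 : x <> pone by move=> E; apply: kN; rewrite E.
rewrite span2_origin_g // span2_origin_h //.
by case: l lP => [y|//] yP; apply: multipleE.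
Qed.

Lemma trans_pts x k : params x -> pts k -> pts (trans x k).
Proof. by case: k => [y|//] xP yP; apply: paramsM. Qed.

Lemma xi_par_invertible x : mx_invertible (xi_par x).
Proof. exact: xi_mx_invertible. Qed.

Lemma psi_par_invertible x : mx_invertible (psi_par x).
Proof. exact: psi_mx_invertible. Qed.

Lemma trans_inj x : injective (trans x).
Proof.
move=> k l e; apply: pt_g_inj; have [B [AB _]] := xi_par_invertible x.
by rewrite -[pt_g k]mulmx1 -[pt_g l]mulmx1 -AB !mulmxA -!pt_g_row e.
Qed.

(** At most one of j, k is infinity, so the other one can be translated to the
    origin, on both sides by the same parameter. *)
Lemma collinear j k l : pts j -> pts k -> pts l -> j <> k ->
  span2 (pt_g j) (pt_g k) (pt_g l) <-> span2 (pt_h j) (pt_h k) (pt_h l).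
Proof.
wlog [x ->] : j k / exists x, j = Some x => [wl|] jP kP lP jk.
  case: j k jP kP jk => [x|] [y|] // jP kP jk; try by apply: wl => //; eexists.
  by rewrite span2C [span2 (pt_h _) _]span2C; apply: wl => //; exists y.
have iP := paramsV jP.
rewrite -(span2_mulmx _ _ _ (xi_par_invertible (pinv x))) -!pt_g_row.
rewrite -(span2_mulmx _ _ _ (psi_par_invertible (pinv x))) -!pt_h_row.
have -> : trans (pinv x) (Some x) = Some pone by rewrite /trans /= pmulV.
apply: collinear_origin; try exact: trans_pts.
by move=> e; apply: jk; apply: (@trans_inj (pinv x)); rewrite e /trans /= pmulV.
Qed.

(** * The group isomorphism and the action on points *)

Lemma xi_mul x y :
  (xi s hsigma x.1 x.2 * xi s hsigma y.1 y.2)%g =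
  xi s hsigma (pmul x y).1 (pmul x y).2.
Proof. by apply: mxclassM; apply: xi_parM. Qed.

Lemma psi_mul x y :
  (psi (of_pair s hsigma x.1) x.2 * psi (of_pair s hsigma y.1) y.2)%g =
  psi (of_pair s hsigma (pmul x y).1) (pmul x y).2.
Proof. by apply: mxclassM; apply: psi_parM. Qed.

Lemma PGL_act_xi x k :
  PGL_act (span1 (pt_g k)) (xi s hsigma x.1 x.2) = span1 (pt_g (trans x k)).
Proof. by rewrite PGL_act_span1 pt_g_row. Qed.

Lemma PGL_act_psi x k :
  PGL_act (span1 (pt_h k)) (psi (of_pair s hsigma x.1) x.2) = span1 (pt_h (trans x k)).
Proof. by rewrite PGL_act_span1 pt_h_row. Qed.

Lemma trans_origin x : trans x (Some pone) = Some x.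
Proof.
case: x => [[a b] p]; rewrite /trans /= /pmul /herm /= !add0r.
by congr (Some (_, _)); rewrite ?sE; ring.
Qed.

(** The class of a matrix is determined by the image of the origin. *)
Lemma xi_inj : injective (fun x => xi s hsigma x.1 x.2).
Proof.
move=> x y /= e; apply: Some_inj; apply: pt_g_inj.
by rewrite -(trans_origin x) -(trans_origin y) -!PGL_act_xi e.
Qed.

Lemma psi_inj : injective (fun x => psi (of_pair s hsigma x.1) x.2).
Proof.
move=> x y /= e; apply: Some_inj; apply: pt_h_inj.
by rewrite -(trans_origin x) -(trans_origin y) -!PGL_act_psi e.
Qed.

Lemma XiE : Xi s hsigma i = [set xi s hsigma x.1 x.2 | x in params].
Proof.
apply/seteqP; split=> [_ [u [p [pP ->]]]|_ [x xP <-]]; first by exists (u, p).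
by exists x.1, x.2.
Qed.

Lemma PsiE : Psi s hsigma i = [set psi (of_pair s hsigma x.1) x.2 | x in params].
Proof.
apply/seteqP; split=> [_ [X [p [pP ->]]]|_ [x xP <-]].
  by exists ((qa X, qb X), p); rewrite //= of_pairK.
by exists (of_pair s hsigma x.1), x.2.
Qed.

Lemma Xi_Psi_iso : exists phi : PGL C 4 -> PGL H 3,
  (forall u p, p \in <[i]>%VS ->
     phi (xi s hsigma u p) = psi (of_pair s hsigma u) p) /\
  group_iso (Xi s hsigma i) (Psi s hsigma i) phi.
Proof.
pose phi A := xget 1%g [set psi (of_pair s hsigma x.1) x.2 | x in
                         [set x | xi s hsigma x.1 x.2 = A]].
have phiE x : phi (xi s hsigma x.1 x.2) = psi (of_pair s hsigma x.1) x.2.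
  by apply: xget_unique => [|_ [y /xi_inj -> <-]]; [exists x|].
exists phi; split=> [u p _|]; first exact: (phiE (u, p)).
rewrite XiE PsiE; split.
- exact: (image_group_closed params1 paramsV paramsM pmul11 pmulV xi_mul).
- exact: (image_group_closed params1 paramsV paramsM pmul11 pmulV psi_mul).
- split=> [_ [x xP <-]|_ _ /set_mem[x _ <-] /set_mem[y _ <-]|_ [x xP <-]].
  + by exists x; rewrite // phiE.
  + by rewrite !phiE => /psi_inj ->.
  + by exists (xi s hsigma x.1 x.2); [exists x | rewrite phiE].
by move=> _ _ /set_mem[x _ <-] /set_mem[y _ <-]; rewrite xi_mul !phiE psi_mul.
Qed.

Section Eta.
Variable eta : set 'rV[C]_4 -> set 'rV[H]_3.
Hypothesis eta_def : is_eta i eta.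

Lemma eta_pt k : pts k -> eta (span1 (pt_g k)) = span1 (pt_h k).
Proof. by case: eta_def => eta0 etaS; case: k => [x xP|_] //; apply: etaS. Qed.

Lemma eta_equivariant x P : params x -> absolute_points (g sigma s) P ->
  PGL_act (eta P) (psi (of_pair s hsigma x.1) x.2) =
  eta (PGL_act P (xi s hsigma x.1 x.2)).
Proof.
move=> xP; have [-> _ _] := g_chart => -[k kP <-].
by rewrite eta_pt // PGL_act_psi PGL_act_xi eta_pt //; apply: trans_pts.
Qed.

Lemma eta_incidence_iso : incidence_iso (g sigma s) (h s hsigma) eta.
Proof.
exact: (chart_incidence_iso field_unit quat_unit g_chart h_chart eta_pt collinear).
Qed.
End Eta.
End Geometry.

Unset Implicit Arguments.
Set Strict Implicit.

Theorem theorem2p10 (R : fieldType) (C : splittingFieldType R)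
    (sigma : gal_of {:C}) (hsigma : quadratic_galois sigma)
    (char_R : 2%N \notin [pchar R])
    (i : C) (i_neq0 : i != 0) (i_sigma : sigma i = - i)
    (s : R) (s_neq0 : s != 0)
    (anisotropic : forall a b : C, (a, b) != (0, 0) ->
       a * sigma a + s *: (b * sigma b) != 0)
    (eta : set 'rV[C]_4 -> set 'rV[quat s hsigma]_3)
    (eta_def : is_eta i eta) :
  (exists phi : PGL C 4 -> PGL (quat s hsigma) 3,
     (forall (u : C * C) (p : C), p \in <[i]>%VS ->
        phi (xi s hsigma u p) = psi (of_pair s hsigma u) p) /\
     group_iso (Xi s hsigma i) (Psi s hsigma i) phi) /\
  (forall (u : C * C) (p : C) (P : set 'rV[C]_4),
     p \in <[i]>%VS -> absolute_points (g sigma s) P ->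
     PGL_act (eta P) (psi (of_pair s hsigma u) p) =
     eta (PGL_act P (xi s hsigma u p))) /\
  incidence_iso (g sigma s) (h s hsigma) eta.
Proof.
split; first exact: Xi_Psi_iso.
split; last exact: (eta_incidence_iso char_R i_neq0 i_sigma anisotropic eta_def).
move=> u p P pP absP.
exact: (eta_equivariant char_R i_neq0 i_sigma anisotropic eta_def (x := (u, p))).
Qed.
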